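(* Let $G=(V,E)$ be a finite simple graph and let $M$ be a doubly nonnegative matrix indexed by $V$. Set $$T:=\mathbf 1^{\top}M\mathbf 1,\qquad S:=\sum_{uv\in E}\sqrt{M_{uv}}.$$ Then $$2S\;\leq\;\sum_{v\in V}\left(1-\frac{1}{c(v)}\right)\sqrt{T}.$$
   Context: A real symmetric matrix $M$ is doubly nonnegative if it is positive semidefinite and entrywise nonnegative. $\mathbf 1$ is the all-ones vector indexed by $V$. The sum over $uv\in E$ runs over unordered edges, each edge counted once. For $v\in V$, the local clique number $c(v)$ is the maximum order of a clique of $G$ containing $v$, i.e. $c(v)=\max\{|Q| : v\in Q\subseteq V,\ G[Q]\text{ is complete}\}$. *)

(* Defs.v *)
From mathcomp Require Import all_boot all_order all_algebra.
From mathcomp Require Import reals.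

Set Implicit Arguments.
Unset Strict Implicit.
Unset Printing Implicit Defensive.

Import Order.TTheory GRing.Theory Num.Theory.
Local Open Scope ring_scope.

Definition simple_graph (V : finType) (adj : rel V) : Prop :=
  symmetric adj /\ irreflexive adj.

Definition is_clique (V : finType) (adj : rel V) (Q : {set V}) : bool :=
  [forall x in Q, forall y in Q, (x != y) ==> adj x y].

(* The singleton [set v] is always a clique, so this is at least 1. *)
Definition local_clique_number (V : finType) (adj : rel V) (v : V) : nat :=
  (\max_(Q : {set V} | (v \in Q) && is_clique adj Q) #|Q|)%N.

Definition psdmx (R : realType) (n : nat) (M : 'M[R]_n) : Prop :=
  M \is symmetricmx /\ forall x : 'cV[R]_n, 0 <= (x^T *m M *m x) 0 0.

Definition doubly_nonnegative (R : realType) (n : nat) (M : 'M[R]_n) : Prop :=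
  psdmx M /\ forall i j, 0 <= M i j.

(* A matrix indexed by a finite type V is an element of 'M[R]_#|V|, whose rows
   and columns are identified with V through the bijection enum_rank. *)
Definition entry (R : realType) (V : finType) (M : 'M[R]_#|V|) (u v : V) : R :=
  M (enum_rank u) (enum_rank v).

Definition total_weight (R : realType) (V : finType) (M : 'M[R]_#|V|) : R :=
  ((const_mx 1 : 'cV[R]_#|V|)^T *m M *m (const_mx 1 : 'cV[R]_#|V|)) 0 0.

(* Each unordered edge is represented by its unique ordering that is increasing
   for enum_rank, so it is counted exactly once. *)
Definition edge_sqrt_sum (R : realType) (V : finType) (adj : rel V)
    (M : 'M[R]_#|V|) : R :=
  \sum_(p : V * V | adj p.1 p.2 && (enum_rank p.1 < enum_rank p.2)%N)
    Num.sqrt (entry M p.1 p.2).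

(* Main.v *)
Require Import Defs.
From mathcomp Require Import all_boot all_order all_algebra.
From mathcomp Require Import reals.
From mathcomp Require Import boolp classical_sets topology normedtype.
From mathcomp Require Import realfun derive.
From mathcomp Require Import ring lra zify.

(** Put [k v = 1 - 1 / c(v)].  The inequality is homogeneous in two ways, and
    after dividing the weights [k] by their sum and [M] by its total it becomes
    the case [b = k / sum k], [N = M / T] of the statement that
      Phi(b, N) = sum over ordered adjacent pairs (u, v) of
                  sqrt ((b u / k u) * (b v / k v) * N u v)
    is at most 1 for all probability vectors [b] and all doubly nonnegative [N]
    of total 1.  The gain is that both [b] and [N] are now free, so that one may
    argue at a maximiser, which exists by compactness ([objective_maximizer]).

    Let [lam] be the maximum and call [load u] the part of the sum with first
    index [u].  Replacing [b u] by [(1 + x)^2 * b u], or multiplying both the row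
    and the column of [u] in [N] by [(1 + x)^2], changes Phi by exactly
    [2 * x * load u].  The first order conditions are therefore
    [load u = lam * b u] ([load_weight]) and [load u = lam * (row sum of u)]
    ([load_row]); in particular the row sums of [N] are the weights [b].

    Suppose [lam > 1].  Let [y u * b u] be the part of row [u] of [N] lying on
    non-neighbours of [u], and [D u] the sum of [b v / k v] over the neighbours
    [v] of [u].  Cauchy-Schwarz applied to [load u] gives
    [k u < (1 - y u) * D u] ([active_D]).  Positive semidefiniteness gives
    [(sum b f)^2 <= f^T N f] for every [f] ([psd_mean]), so an independent set on
    which [y <= y0] has weight at most [y0].

    Take a clique [Q] in the support of [b], of maximum size [r] and then with
    the sum of [y] over [Q] maximal.  The vertices adjacent to all of [Q] except
    [q] form an independent set [U_q], and exchanging one of them with [q] shows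
    [y <= y q] on it; hence its weight [u_q] is at most [y q].  If all [c v] equal
    [r], this already ends the proof: with [k = 1 - 1/r] and [w] the sum of the
    [u_q] we get [D q > k / (1 - u_q)], hence [sum D > k * r^2 / (r - w)], whereas
    a vertex is adjacent to [r - 1] members of [Q] when it lies in some [U_q] and
    to at most [r - 2] otherwise, so [k * sum D <= r - 2 + w]; these bounds are
    incompatible because [(r - w) * (r - 2 + w) <= (r - 1)^2].

    For varying [c], the vertices with [c v < r] enter [D] with a larger factor
    [1 / k v].  Counting neighbours in [Q] ([coef_bound]) shows that this hurts
    only for the set [S] of vertices with [c v = r - 1] that miss exactly two
    members of [Q].  But a vertex of [S] missing [q] cannot be adjacent to [U_q],
    for otherwise it would lie in a clique of size [r].  Positive
    semidefiniteness uses this separation ([independent_mass]) to improve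
    [u_q <= y q] to [u_q <= y q * (1 - s_q)], with [s_q] the weight of the vertices
    of [S] that miss [q].  An elementary inequality ([separation_gain])
    turns the resulting lower bound on [D q] into one that is linear in the
    weights; its sum over [Q] contradicts the upper bound on [sum D]
    ([sum_D_le]). *)

Set Implicit Arguments.
Unset Strict Implicit.
Unset Printing Implicit Defensive.

Import Order.TTheory GRing.Theory Num.Theory.
Import numFieldNormedType.Exports.
Import ArrowAsProduct.
Local Open Scope ring_scope.

(** * Doubly nonnegative kernels and the normalised objective *)

Definition qform (R : realType) (V : finType) (N : V -> V -> R) (f : V -> R) : R :=
  \sum_u \sum_v f u * f v * N u v.

Definition total_mass (R : realType) (V : finType) (N : V -> V -> R) : R :=
  \sum_u \sum_v N u v.

(** [doubly_nonnegative] for matrices whose rows and columns are indexed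
    directly by [V]. *)
Definition dnn_kernel (R : realType) (V : finType) (N : V -> V -> R) : Prop :=
  [/\ forall u v, N u v = N v u, forall u v, 0 <= N u v & forall f, 0 <= qform N f].

(** The contribution of [u] to Phi; [g] stands for the inverses [1 / k]. *)
Definition load (R : realType) (V : finType) (e : rel V) (g b : V -> R) (N : V -> V -> R) (u : V) : R :=
  \sum_(v | e u v) Num.sqrt (g u * b u * (g v * b v) * N u v).

Definition objective (R : realType) (V : finType) (e : rel V) (g b : V -> R) (N : V -> V -> R) : R :=
  \sum_u load e g b N u.

(** * Existence of a maximiser *)

(** Feasible sets given by arbitrarily many weak inequalities between continuous
    functions are closed, and closed subsets of the cube are compact by
    Tychonoff.  The index type [J] is arbitrary because positive
    semidefiniteness is one inequality for each test vector. *)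
Lemma exists_maximizer (R : realType) (I : finType) (J : Type)
    (g : J -> (I -> R) -> R) (f : (I -> R) -> R) :
    (forall j, continuous (g j)) -> continuous f ->
    (exists x, forall j, 0 <= g j x) ->
    (forall x, (forall j, 0 <= g j x) -> forall i, 0 <= x i <= 1) ->
  exists2 x, (forall j, 0 <= g j x) &
    forall y, (forall j, 0 <= g j y) -> f y <= f x.
Proof.
move=> cg cf [x0 x0P] bnd.
pose K : set (I -> R) := (\bigcap_(j in setT) [set x : I -> R | 0 <= g j x])%classic.
have KE x : K x <-> forall j, 0 <= g j x.
  by split=> [h j|h j _]; [exact: h|exact: h].
have cK : compact K.
  apply: (@subclosed_compact _ _ [set x : I -> R | forall i, `[0, 1]%classic (x i)]).
  - apply: closed_bigI => j _.
    have -> : [set x : I -> R | 0 <= g j x]%classic = (g j @^-1` [set y | 0 <= y])%classic by [].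
    by apply: closed_comp; [move=> x _; exact: cg|exact: closed_ge].
  - by apply: (@tychonoff I (fun=> R) (fun=> `[0, 1]%classic)) => i; exact: segment_compact.
  - move=> x /KE h i /=; rewrite in_itv /=; exact: bnd.
have [|c cK' cmax] := compact_EVT_max _ cK (continuous_subspaceT cf).
  by exists x0; apply/KE.
exists c; first by apply/KE; rewrite inE in cK'.
by move=> y yP; apply: cmax; rewrite inE; apply/KE.
Qed.

Lemma continuous_coord (R : realType) (I : finType) (i : I) :
  continuous (fun x : I -> R => x i).
Proof. exact: (@proj_continuous I (fun=> R) i). Qed.

Lemma continuous_sum (R : realType) (X : topologicalType) (T : Type) (r : seq T)
    (P : pred T) (F : T -> X -> R) :
  (forall t, continuous (F t)) -> continuous (fun x => \sum_(t <- r | P t) F t x).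
Proof.
move=> cF; elim: r => [|t r IH].
  rewrite (_ : (fun x : X => _) = fun=> 0); first exact: cst_continuous.
  by apply/funext => x; rewrite big_nil.
have [Pt|Pt] := boolP (P t).
  rewrite (_ : (fun x : X => _) =
    (fun x : X => F t x + \sum_(t <- r | P t) F t x)); last first.
    by apply/funext => x; rewrite big_cons Pt.
  by move=> x; apply: cvgD; [exact: cF|exact: IH].
rewrite (_ : (fun x : X => _) = (fun x : X => \sum_(t <- r | P t) F t x)) //.
by apply/funext => x; rewrite big_cons (negbTE Pt).
Qed.

Lemma continuous_mul (R : realType) (X : topologicalType) (f g : X -> R) :
  continuous f -> continuous g -> continuous (fun x => f x * g x).
Proof. by move=> cf cg x; apply: cvgM; [exact: cf|exact: cg]. Qed.

Lemma continuous_sub (R : realType) (X : topologicalType) (f g : X -> R) :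
  continuous f -> continuous g -> continuous (fun x => f x - g x).
Proof. by move=> cf cg x; apply: cvgB; [exact: cf|exact: cg]. Qed.

Lemma continuous_cst (R : realType) (X : topologicalType) (a : R) :
  continuous (fun _ : X => a).
Proof. exact: cst_continuous. Qed.

Lemma continuous_sqrtr (R : realType) (X : topologicalType) (f : X -> R) :
  continuous f -> continuous (fun x => Num.sqrt (f x)).
Proof.
move=> cf x; apply: (@continuous_comp _ _ _ f (@Num.sqrt R)); first exact: cf.
exact: sqrt_continuous.
Qed.

(** A point of the parameter space is one function on [V + V * V], so that the
    weights and the kernel vary together in a single product space. *)
Definition weight_of (R : realType) (V : finType) (x : (V + V * V)%type -> R) (v : V) : R := x (inl v).
Definition kernel_of (R : realType) (V : finType) (x : (V + V * V)%type -> R) (u v : V) : R := x (inr (u, v)).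

(** The equality constraints are each written as two inequalities.  The
    vertex [v0] provides a feasible point, concentrated at [v0]. *)
Lemma objective_maximizer (R : realType) (V : finType) (e : rel V) (g : V -> R) (v0 : V) :
  exists b N, [/\ forall v, 0 <= b v, \sum_v b v = 1, dnn_kernel N, total_mass N = 1 &
    forall b' N', (forall v, 0 <= b' v) -> \sum_v b' v = 1 -> dnn_kernel N' -> total_mass N' = 1 ->
      objective e g b' N' <= objective e g b N].
Proof.
pose X := (V + V * V)%type.
pose PX : topologicalType := prod_topology (fun _ : X => R).
pose J := (bool + (X + (V * V) + (V -> R) + bool))%type.
pose c (j : J) (x : X -> R) : R := match j with
  | inl true => \sum_v weight_of x v - 1
  | inl false => 1 - \sum_v weight_of x v
  | inr (inl (inl (inl i))) => x i
  | inr (inl (inl (inr (u, v)))) => kernel_of x u v - kernel_of x v u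
  | inr (inl (inr f)) => qform (kernel_of x) f
  | inr (inr true) => total_mass (kernel_of x) - 1
  | inr (inr false) => 1 - total_mass (kernel_of x)
  end.
have cE x : (forall j, 0 <= c j x) <->
  [/\ forall v, 0 <= weight_of x v, \sum_v weight_of x v = 1,
     dnn_kernel (kernel_of x) & total_mass (kernel_of x) = 1].
  split=> [h|[h1 h2 [h3 h4 h5] h6]].
    have hx i : 0 <= x i by exact: (h (inr (inl (inl (inl i))))).
    split=> [v||| ].
    - exact: hx.
    - by apply/eqP; rewrite eq_le -subr_ge0 (h (inl false)) -subr_ge0 (h (inl true)).
    - split=> [u v|u v|f].
      + apply/eqP; rewrite eq_le -subr_ge0 (h (inr (inl (inl (inr (v, u)))))).
        by rewrite -subr_ge0 (h (inr (inl (inl (inr (u, v)))))).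
      + exact: hx.
      + exact: (h (inr (inl (inr f)))).
    - by apply/eqP; rewrite eq_le -subr_ge0 (h (inr (inr false))) -subr_ge0 (h (inr (inr true))).
  case=> [[]|[[[i|[u v]]|f]|[]]] /=; rewrite ?h2 ?h6 ?subrr//.
  - by case: i => [v|[u v]]; [exact: h1|exact: h4].
  - by rewrite h3 subrr.
have cw v : continuous (fun x : X -> R => weight_of x v) by exact: continuous_coord.
have cm u v : continuous (fun x : X -> R => kernel_of x u v) by exact: continuous_coord.
have ct : continuous (fun x : X -> R => total_mass (kernel_of x)).
  by apply: (@continuous_sum R PX) => u; apply: (@continuous_sum R PX) => v; exact: cm.
have cb : continuous (fun x : X -> R => \sum_v weight_of x v).
  by apply: (@continuous_sum R PX) => v; exact: cw.
have [j|||x h i|x xP xmax] := @exists_maximizer R X J c (fun x => objective e g (weight_of x) (kernel_of x)).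
- case: j => [[]|[[[i|[u v]]|f]|[]]] /=.
  + by apply: (@continuous_sub R PX); [exact: cb|exact: (@continuous_cst R PX)].
  + by apply: (@continuous_sub R PX); [exact: (@continuous_cst R PX)|exact: cb].
  + exact: continuous_coord.
  + by apply: (@continuous_sub R PX); exact: cm.
  + apply: (@continuous_sum R PX) => u; apply: (@continuous_sum R PX) => v.
    by apply: (@continuous_mul R PX); [exact: (@continuous_cst R PX)|exact: cm].
  + by apply: (@continuous_sub R PX); [exact: ct|exact: (@continuous_cst R PX)].
  + by apply: (@continuous_sub R PX); [exact: (@continuous_cst R PX)|exact: ct].
- apply: (@continuous_sum R PX) => u; apply: (@continuous_sum R PX) => v.
  apply: (@continuous_sqrtr R PX); apply: (@continuous_mul R PX); last exact: cm.
  by apply: (@continuous_mul R PX); apply: (@continuous_mul R PX);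
    solve [exact: (@continuous_cst R PX)|exact: cw].
- have dE (F : V -> V -> R) :
      \sum_u \sum_v F u v * ((u == v0) && (v == v0))%:R = F v0 v0.
    rewrite (bigD1 v0)//= [X in _ + X]big1 ?addr0 => [|u /negbTE un]; last first.
      by rewrite big1// => v _; rewrite un mulr0.
    rewrite (bigD1 v0)//= eqxx mulr1 big1 ?addr0// => v vn.
    by rewrite (negbTE vn) mulr0.
  exists (fun i => match i with inl v => (v == v0)%:R
                 | inr (u, v) => ((u == v0) && (v == v0))%:R end).
  apply/cE; split=> [v||| ].
  - by rewrite /weight_of; case: (v == v0).
  - by rewrite (bigD1 v0)//= /weight_of eqxx big1 ?addr0// => v /negbTE ->.
  - split=> [u v|u v|f]; rewrite ?/kernel_of.
    + by rewrite andbC.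
    + by case: (_ && _).
    + by rewrite /qform (dE (fun u v => f u * f v)) -expr2 sqr_ge0.
  - rewrite /total_mass -[RHS](dE (fun _ _ => 1)).
    by apply: eq_bigr => u _; apply: eq_bigr => v _; rewrite mul1r.
- have [h1 h2 [h3 h4 h5] h6] := (iffLR (cE x)) h.
  case: i => [v|[u v]]; apply/andP; split.
  + exact: h1.
  + by rewrite -h2 (bigD1 v)//= ler_wpDr// sumr_ge0.
  + exact: h4.
  + rewrite -h6 /total_mass (bigD1 u)//= (bigD1 v)//= -addrA ler_wpDr//.
    by rewrite addr_ge0// sumr_ge0// => w _; rewrite sumr_ge0.
have [h1 h2 h3 h6] := (iffLR (cE x)) xP.
exists (weight_of x), (kernel_of x); split=> // b' N' b0 b1 dN N1.
pose y : X -> R := fun i => match i with inl v => b' v | inr (u, v) => N' u v end.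
exact: (xmax y (iffRL (cE y) (And4 b0 b1 dN N1))).
Qed.

(** * First order conditions at a maximiser *)

Lemma sum_delta (R : realType) (V : finType) (u : V) (F : V -> R) :
  \sum_w (w == u)%:R * F w = F u.
Proof.
rewrite (bigD1 u)//= eqxx mul1r big1 ?addr0// => w /negbTE ->.
by rewrite mul0r.
Qed.

(** The effect on the sum of a symmetric kernel of multiplying the row and the
    column of [u] by [1 + x]. *)
Lemma bump_sum (R : realType) (V : finType) (q : V -> V -> R) (u : V) (x : R) :
    (forall v w, q v w = q w v) ->
  \sum_w \sum_v (1 + x * (w == u)%:R) * (1 + x * (v == u)%:R) * q w v =
  \sum_w \sum_v q w v + 2 * x * \sum_v q u v + x ^+ 2 * q u u.
Proof.
move=> qS.
transitivity (\sum_w ((\sum_v q w v) + x * ((w == u)%:R * \sum_v q w v)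
  + x * (q w u) + x ^+ 2 * ((w == u)%:R * q w u))).
  apply: eq_bigr => w _.
  transitivity (\sum_v (q w v + x * (w == u)%:R * q w v
     + x * ((v == u)%:R * q w v) + x ^+ 2 * (w == u)%:R * ((v == u)%:R * q w v))).
    by apply: eq_bigr => v _; ring.
  rewrite !big_split/= -!mulr_sumr !sum_delta; ring.
rewrite !big_split/= -!mulr_sumr !sum_delta.
under [X in _ + x * X + _]eq_bigr do rewrite qS.
ring.
Qed.

(** The first order condition at an interior extremum, with an explicit
    quadratic error in place of a derivative. *)
Lemma first_order_eq (R : realType) (a c k : R) :
  (forall x, `|x| <= 1 / 4 -> a * x <= c * x + k * x ^+ 2) -> a = c.
Proof.
move=> h; apply/eqP; rewrite -subr_eq0; apply/eqP.
set d := a - c; apply/eqP; apply: contraT => d0.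
have nd : 0 < `|d| by rewrite normr_gt0.
have nk := normr_ge0 k.
have P : 0 < 4 * (1 + `|d|) * (1 + `|k|) by apply: mulr_gt0; lra.
(* [x = d * t] has the sign of [d] and is small enough for the quadratic term
   to be at most a quarter of the linear one. *)
pose t := (4 * (1 + `|d|) * (1 + `|k|))^-1.
have t0 : 0 < t by rewrite invr_gt0.
have tP : t * (4 * (1 + `|d|) * (1 + `|k|)) = 1 by rewrite mulVf// gt_eqF.
have td : `|d| * t <= 1 / 4 by nra.
have tk : `|k| * t <= 1 / 4 by nra.
have := h (d * t); rewrite normrM (gtr0_norm t0) => /(_ td) H.
have d2 : 0 < d ^+ 2 * t by rewrite mulr_gt0// exprn_even_gt0.
have H1 : d ^+ 2 * t <= k * t * (d ^+ 2 * t) by rewrite /d in H *; nra.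
have : k * t * (d ^+ 2 * t) <= 1 / 4 * (d ^+ 2 * t).
  rewrite ler_pM2r//; apply: le_trans tk; rewrite ler_pM2r//; exact: ler_norm.
nra.
Qed.

Section Stationarity.
Variables (R : realType) (V : finType) (e : rel V) (g : V -> R).
Hypotheses (eS : symmetric e) (eI : irreflexive e).

(** Squared scaling factors leave the square roots of the objective as
    polynomial factors, so that the perturbations below are exact and no
    square root is differentiated. *)
Lemma objective_scale (b : V -> R) (N : V -> V -> R) (s t : V -> R) :
  (forall v, 0 <= s v) -> (forall v, 0 <= t v) ->
  objective e g (fun v => s v ^+ 2 * b v) (fun u v => t u ^+ 2 * t v ^+ 2 * N u v) =
  \sum_u \sum_(v | e u v) s u * t u * (s v * t v) * Num.sqrt (g u * b u * (g v * b v) * N u v).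
Proof.
move=> s0 t0; apply: eq_bigr => u _; apply: eq_bigr => v _.
rewrite -[X in X * Num.sqrt _]ger0_norm ?mulr_ge0// -sqrtr_sqr -sqrtrM ?sqr_ge0//.
by congr Num.sqrt; ring.
Qed.

Lemma total_ge0 (N : V -> V -> R) : dnn_kernel N -> 0 <= total_mass N.
Proof. by move=> [_ N0 _]; rewrite sumr_ge0// => u _; rewrite sumr_ge0. Qed.

Lemma dnn_conj (N : V -> V -> R) (t : V -> R) : (forall v, 0 <= t v) -> dnn_kernel N ->
  dnn_kernel (fun u v => t u ^+ 2 * t v ^+ 2 * N u v).
Proof.
move=> t0 [NS N0 Np]; split=> [u v|u v|f].
- by rewrite NS; ring.
- by rewrite !mulr_ge0// ?sqr_ge0.
- have := Np (fun v => t v ^+ 2 * f v); rewrite /qform.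
  congr (_ <= _); apply: eq_bigr => u _; apply: eq_bigr => v _; ring.
Qed.

Variables (b : V -> R) (N : V -> V -> R).
Hypotheses (b0 : forall v, 0 <= b v) (b1 : \sum_v b v = 1) (dN : dnn_kernel N) (N1 : total_mass N = 1).
Hypothesis bN_max : forall b' N', (forall v, 0 <= b' v) -> \sum_v b' v = 1 ->
  dnn_kernel N' -> total_mass N' = 1 -> objective e g b' N' <= objective e g b N.
Let lam := objective e g b N.

(** Maximality among normalised pairs in homogeneous form: the objective has
    degree 1 in the weights and degree 1/2 in the kernel. *)
Lemma objective_bound (b' : V -> R) (N' : V -> V -> R) :
  (forall v, 0 <= b' v) -> 0 < \sum_v b' v -> dnn_kernel N' -> 0 < total_mass N' ->
  objective e g b' N' <= lam * (\sum_v b' v) * Num.sqrt (total_mass N').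
Proof.
move=> b'0 sb dN' T0; set sg := \sum_v _ in sb *; set T := total_mass N' in T0 *.
pose s := Num.sqrt sg^-1.
pose t := Num.sqrt (Num.sqrt T^-1).
have s2 : s ^+ 2 = sg^-1 by rewrite sqr_sqrtr// invr_ge0 ltW.
have t4 : t ^+ 2 * t ^+ 2 = T^-1.
  by rewrite sqr_sqrtr ?sqrtr_ge0// -expr2 sqr_sqrtr// invr_ge0 ltW.
have := bN_max (b' := fun v => s ^+ 2 * b' v) (N' := fun u v => t ^+ 2 * t ^+ 2 * N' u v).
have -> : objective e g (fun v => s ^+ 2 * b' v) (fun u v => t ^+ 2 * t ^+ 2 * N' u v)
   = sg^-1 * (Num.sqrt T)^-1 * objective e g b' N'.
  rewrite (@objective_scale b' N' (fun=> s) (fun=> t))//; try by move=> _; exact: sqrtr_ge0.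
  rewrite /objective mulr_sumr; apply: eq_bigr => u _.
  rewrite /load mulr_sumr; apply: eq_bigr => v _; congr (_ * _).
  have <- : t ^+ 2 = (Num.sqrt T)^-1 by rewrite sqr_sqrtr ?sqrtr_ge0// sqrtrV// ltW.
  by rewrite -s2; ring.
have H1 v : 0 <= s ^+ 2 * b' v by rewrite mulr_ge0// sqr_ge0.
have H2 : \sum_v s ^+ 2 * b' v = 1 by rewrite -mulr_sumr s2 mulVf// gt_eqF.
have H3 : dnn_kernel (fun u v => t ^+ 2 * t ^+ 2 * N' u v).
  by apply: (@dnn_conj N' (fun=> t)) => // _; exact: sqrtr_ge0.
have H4 : total_mass (fun u v => t ^+ 2 * t ^+ 2 * N' u v) = 1.
  rewrite /total_mass (eq_bigr (fun u => T^-1 * \sum_v N' u v)) => [|u _].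
    by rewrite -mulr_sumr mulVf// gt_eqF.
  by rewrite mulr_sumr t4.
move=> /(_ H1 H2 H3 H4).
have sT : 0 < Num.sqrt T by rewrite sqrtr_gt0.
by rewrite -/lam -invfM mulrC ler_pdivrMr ?mulr_gt0// mulrA.
Qed.

(** The diagonal term is absent because [e] is irreflexive, so that the change
    is linear in [x]. *)
Lemma objective_bump (u : V) (x : R) (s t : V -> R) :
  (forall v, 0 <= s v) -> (forall v, 0 <= t v) ->
  (forall v, s v * t v = 1 + x * (v == u)%:R) ->
  objective e g (fun v => s v ^+ 2 * b v) (fun u v => t u ^+ 2 * t v ^+ 2 * N u v) =
  lam + 2 * x * load e g b N u.
Proof.
move=> s0 t0 st; rewrite objective_scale//.
pose q v w := (e v w)%:R * Num.sqrt (g v * b v * (g w * b w) * N v w).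
have [NS _ _] := dN.
have qS v w : q v w = q w v.
  by rewrite /q eS NS; congr (_ * Num.sqrt _); ring.
have qE (F : V -> R) w : \sum_(v | e w v) F v * Num.sqrt (g w * b w * (g v * b v) * N w v)
    = \sum_v F v * q w v.
  rewrite big_mkcond/=; apply: eq_bigr => v _; rewrite /q.
  by case: (e w v); rewrite ?mul1r ?mul0r ?mulr0.
transitivity (\sum_w \sum_v (1 + x * (w == u)%:R) * (1 + x * (v == u)%:R) * q w v).
  apply: eq_bigr => w _; rewrite -qE; apply: eq_bigr => v _.
  by rewrite !st.
have loadE w : load e g b N w = \sum_v q w v.
  rewrite /load -[LHS](eq_bigr _ (fun v _ => mul1r _)) qE.
  by apply: eq_bigr => v _; rewrite mul1r.
have quu : q u u = 0 by rewrite /q eI mul0r.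
rewrite bump_sum// loadE quu mulr0 addr0; congr (_ + _).
by apply: eq_bigr => w _; rewrite loadE.
Qed.

Lemma row_le1 u : \sum_v N u v <= 1.
Proof.
have [_ N0 _] := dN; rewrite -N1 /total_mass [leRHS](bigD1 u)//= ler_wpDr// sumr_ge0// => w _.
by rewrite sumr_ge0.
Qed.

(** First order condition in the weight of [u]: under
    [b u -> (1 + x)^2 * b u] the bound of [objective_bound] grows by
    [2 * x * lam * b u] to first order. *)
Lemma load_weight (u : V) : load e g b N u = lam * b u.
Proof.
suff : 2 * load e g b N u = 2 * (lam * b u) by lra.
have bu : b u <= 1 by rewrite -b1 (bigD1 u)//= ler_wpDr// sumr_ge0.
apply: (@first_order_eq _ _ _ (lam * b u)) => x; rewrite ler_norml => /andP[xl xr].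
pose s v := 1 + x * (v == u)%:R.
have s0 v : 0 <= s v by rewrite /s; case: (v == u) => /=; lra.
have sE : \sum_v s v ^+ 2 * b v = 1 + (2 * x + x ^+ 2) * b u.
  transitivity (\sum_v (b v + (2 * x + x ^+ 2) * ((v == u)%:R * b v))).
    by apply: eq_bigr => v _; rewrite /s; case: (v == u) => /=; ring.
  by rewrite big_split/= -mulr_sumr sum_delta b1.
have := @objective_bound (fun v => s v ^+ 2 * b v) (fun u v => 1 ^+ 2 * 1 ^+ 2 * N u v).
rewrite (@objective_bump u x s (fun=> 1))//; last by move=> v; rewrite mulr1.
have -> : total_mass (fun u v => 1 ^+ 2 * 1 ^+ 2 * N u v) = 1.
  rewrite -[RHS]N1; apply: eq_bigr => w _; apply: eq_bigr => v _.
  by rewrite expr1n !mul1r.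
rewrite sE sqrtr1 mulr1 => /(_ _ _ _ ltr01) H.
have := H _ _ _.
have h1 v : 0 <= s v ^+ 2 * b v by rewrite mulr_ge0// sqr_ge0.
have h2 : 0 < 1 + (2 * x + x ^+ 2) * b u by have := b0 u; nra.
have h3 : dnn_kernel (fun u v => 1 ^+ 2 * 1 ^+ 2 * N u v) by exact: (@dnn_conj N (fun=> 1)).
by move=> /(_ h1 h2 h3); lra.
Qed.

(** First order condition in the kernel: multiplying the row and the column of
    [u] by [(1 + x)^2] keeps [N] doubly nonnegative, and the square root of its
    total grows by [2 * x] times the row sum to first order. *)
Lemma load_row (u : V) : load e g b N u = lam * \sum_v N u v.
Proof.
set n := \sum_v _.
suff : 2 * load e g b N u = 2 * (lam * n) by lra.
have [NS N0 _] := dN.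
have n1 : n <= 1 by exact: row_le1.
have Nn : N u u <= n by rewrite /n (bigD1 u)//= ler_wpDr// sumr_ge0.
have Nu := N0 u u.
have lam0 : 0 <= lam.
  by apply: sumr_ge0 => w _; apply: sumr_ge0 => v _; exact: sqrtr_ge0.
apply: (@first_order_eq _ _ _ (lam * (n + 3 * N u u))) => x.
rewrite ler_norml => /andP[xl xr].
pose t v := 1 + x * (v == u)%:R.
have t0 v : 0 <= t v by rewrite /t; case: (v == u) => /=; lra.
pose y := 2 * x + x ^+ 2.
have tE : total_mass (fun u v => t u ^+ 2 * t v ^+ 2 * N u v) = 1 + 2 * y * n + y ^+ 2 * N u u.
  rewrite -[X in _ = X + _ + _]N1 -(@bump_sum R V N u y)//.
  apply: eq_bigr => w _; apply: eq_bigr => v _; rewrite /t /y.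
  by case: (w == u); case: (v == u) => /=; ring.
have := @objective_bound (fun v => 1 ^+ 2 * b v) (fun u v => t u ^+ 2 * t v ^+ 2 * N u v).
rewrite (@objective_bump u x (fun=> 1) t)//; last by move=> v; rewrite mul1r.
have -> : \sum_v 1 ^+ 2 * b v = 1.
  by rewrite -[RHS]b1; apply: eq_bigr => v _; rewrite expr1n mul1r.
rewrite tE mulr1.
have h1 v : 0 <= 1 ^+ 2 * b v by rewrite expr1n mul1r.
have h3 : dnn_kernel (fun u v => t u ^+ 2 * t v ^+ 2 * N u v) by exact: dnn_conj.
have y2 : y ^+ 2 <= 6 * x ^+ 2.
  have -> : y ^+ 2 = (2 + x) ^+ 2 * x ^+ 2 by rewrite /y; ring.
  by rewrite ler_wpM2r ?sqr_ge0//; nra.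
have h4 : 0 < 1 + 2 * y * n + y ^+ 2 * N u u.
  have yl : - (7 / 16) <= y by rewrite /y; nra.
  have := mulr_ge0 (sqr_ge0 y) Nu; nra.
move=> /(_ h1 ltr01 h3 h4) H.
set z := 2 * y * n + y ^+ 2 * N u u.
(* The square of the right side exceeds the radicand by a square. *)
have sq : Num.sqrt (1 + 2 * y * n + y ^+ 2 * N u u) <= 1 + y * n + y ^+ 2 * N u u / 2.
  rewrite -[leRHS]ger0_norm; last by lra.
  by rewrite -sqrtr_sqr ler_wsqrtr// -subr_ge0; have := sqr_ge0 (y * n + y ^+ 2 * N u u / 2); lra.
have H2 := le_trans H (ler_wpM2l lam0 sq).
have : lam * (y ^+ 2 * N u u / 2) <= lam * (6 * x ^+ 2 * N u u / 2).
  by apply: ler_wpM2l => //; rewrite ler_pM2r ?invr_gt0// ler_wpM2r.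
rewrite /y in H2 *; nra.
Qed.

End Stationarity.

(** * Inequalities between real numbers *)

(** The lower bound [(1 - 1/r) * (1 + u / (1 - u - s))] available for a single
    [D q] is not linear in the weights [u] and [s], so it cannot be summed over
    [q]; this replaces it by a linear one.  For [s = m = 0] it is the tangent at
    [u = 1/r], the value at which the argument for constant clique numbers is
    tight.  The slot [m] receives [s] minus the correction of [away_S_le]; that
    is why it may be negative. *)
Lemma separation_gain (R : realType) (r u s m : R) :
  2 <= r -> 0 <= u -> 0 <= s -> u + s < 1 -> m <= s -> m <= 2 / r ->
  (1 - 1 / r) + u + (u + m / 2 - 1 / r) / (r - 1)
    <= (1 - 1 / r) * (1 + u / (1 - u - s)).
Proof.
move=> r2 u0 s0 us ms mr.
have r0 : 0 < r by lra.
have r1 : 0 < r - 1 by lra.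
have t0 : 0 < 1 - u - s by lra.
pose th := r^-1.
have thr : r * th = 1 by rewrite /th mulfV// gt_eqF.
have th0 : 0 < th by rewrite /th invr_gt0.
pose z := Num.max m 0.
have z0 : 0 <= z by rewrite /z le_max lexx orbT.
have mz : m <= z by rewrite /z le_max lexx.
have zs : z <= s by rewrite /z ge_max ms.
have zr : z <= 2 * th by rewrite /z ge_max; apply/andP; split; [exact: mr|lra].
(* What remains after clearing denominators.  For large [z] all terms are
   nonnegative after regrouping; otherwise complete the square in [u]. *)
have key : 0 <= r * (u - th)^+2 + (r + 2^-1) * u * z + z^+2 / 2 - z * (2^-1 + th).
  have [h|h] := leP 2 ((r + 2^-1) * z).
    have -> : r * (u - th)^+2 + (r + 2^-1) * u * z + z^+2 / 2 - z * (2^-1 + th)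
      = r * u^+2 + u * ((r + 2^-1) * z - 2 * (r * th)) + (1 - z) * (2 * th - z) / 2
        + th * (r * th - 1) by field.
    rewrite thr; nra.
  have -> : r * (u - th)^+2 + (r + 2^-1) * u * z + z^+2 / 2 - z * (2^-1 + th)
      = ((2 * r * u + (r + 2^-1) * z - 2)^+2
         + z * (2 * (r - 1) - (r - 2^-1)^+2 * z)) / (4 * r).
    by rewrite /th; field; rewrite gt_eqF.
  apply: divr_ge0; last lra.
  apply: addr_ge0; first exact: sqr_ge0.
  apply: mulr_ge0 => //.
  have h2 : 0 <= (r + 2^-1) * (2 * (r - 1) - (r - 2^-1)^+2 * z).
    have : 0 <= (r - 2^-1)^+2 * (2 - (r + 2^-1) * z).
      by apply: mulr_ge0; [exact: sqr_ge0|lra].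
    nra.
  by rewrite pmulr_rge0 in h2; lra.
have main : (u + z / 2 - th) * (1 - u - z) <= (r - 1) * u * (u + z - th).
  have -> : (r - 1) * u * (u + z - th) = (u + z / 2 - th) * (1 - u - z)
     + (r * (u - th)^+2 + (r + 2^-1) * u * z + z^+2 / 2 - z * (2^-1 + th))
     + (r * th - 1) * (u - th) by field.
  by rewrite thr; lra.
have main2 : u + (u + z / 2 - th) / (r - 1) <= (1 - th) * (u / (1 - u - z)).
  have tz : 0 < 1 - u - z by lra.
  rewrite -subr_ge0.
  have -> : (1 - th) * (u / (1 - u - z)) - (u + (u + z / 2 - th) / (r - 1))
    = ((r - 1) * u * (u + z - th) - (u + z / 2 - th) * (1 - u - z))
       / ((1 - u - z) * (r - 1)).
    by field; rewrite !gt_eqF.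
  by apply: divr_ge0; [rewrite subr_ge0|apply: mulr_ge0; lra].
have th1 : th <= 1 by nra.
have step1 : (u + m / 2 - th) / (r - 1) <= (u + z / 2 - th) / (r - 1).
  by rewrite ler_pM2r ?invr_gt0//; lra.
have step2 : (1 - th) * (u / (1 - u - z)) <= (1 - th) * (u / (1 - u - s)).
  apply: ler_wpM2l; first lra.
  by apply: ler_wpM2l => //; rewrite lef_pV2 ?posrE; lra.
rewrite !div1r -/th mulrDr mulr1.
lra.
Qed.

(** A vertex with clique number [c] and with [p] neighbours in an [r]-clique has
    the coefficient [p / (1 - 1/c)] in the sum of [D] over that clique.  The
    coefficient is at most [r] when [p = r - 1], at most [r - 1] when [c = r - 1]
    and [p = r - 2], at most [r - 2] when otherwise [c < r], and at most
    [r - 1 - 1 / (r - 1)] in the remaining cases. *)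
Lemma coef_bound (R : realType) (c p r : nat) :
  (2 <= c)%N -> (p.+1 <= c)%N -> (p.+1 <= r)%N -> (2 <= r)%N ->
  (1 - 1 / c%:R)^-1 * p%:R <= (r%:R - 1) + (p.+1 == r)%:R
    - ((c < r)%N && ~~ ((p.+2 == r) && (c.+1 == r)))%:R
    - ((r <= c)%N && (p.+1 != r))%:R / (r%:R - 1) :> R.
Proof.
move=> c2 pc pr r2.
have C2 : 2 <= c%:R :> R by rewrite (ler_nat _ 2).
have R2 : 2 <= r%:R :> R by rewrite (ler_nat _ 2).
have P0 : 0 <= p%:R :> R by [].
have -> : (1 - 1 / c%:R)^-1 * p%:R = c%:R * p%:R / (c%:R - 1) :> R.
  by field; rewrite !gt_eqF//; lra.
rewrite ler_pdivrMr; last lra.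
have PC : p%:R + 1 <= c%:R :> R by rewrite -(natrD _ p 1) ler_nat addn1.
have PR : p%:R + 1 <= r%:R :> R by rewrite -(natrD _ p 1) ler_nat addn1.
have [pr1|pr1] := eqVneq p.+1 r.
  have -> : (c < r)%N = false by lia.
  have -> : (r <= c)%N by lia.
  have E : p%:R + 1 = r%:R :> R by rewrite -pr1 -(natrD _ p 1) addn1.
  rewrite /= mul0r; nra.
have PR2 : p%:R + 2 <= r%:R :> R by rewrite -(natrD _ p 2) ler_nat; lia.
have [cr|rc] := ltnP c r => /=.
  rewrite mul0r.
  have [/andP[/eqP pr2 /eqP cr1]|ns] := boolP (_ && _) => /=.
    have E : p%:R + 2 = r%:R :> R by rewrite -pr2 -(natrD _ p 2) addn2.
    have E2 : c%:R + 1 = r%:R :> R by rewrite -cr1 -(natrD _ c 1) addn1.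
    nra.
  have [cr1|cr1] := eqVneq c.+1 r.
    have E2 : c%:R + 1 = r%:R :> R by rewrite -cr1 -(natrD _ c 1) addn1.
    have PR3 : p%:R + 3 <= r%:R :> R.
      by rewrite -(natrD _ p 3) ler_nat; move: ns; rewrite cr1 eqxx andbT; lia.
    nra.
  have E2 : c%:R + 2 <= r%:R :> R by rewrite -(natrD _ c 2) ler_nat; lia.
  nra.
rewrite subr0.
have RC : r%:R <= c%:R :> R by rewrite ler_nat.
have r1 : 0 < r%:R - 1 :> R by lra.
rewrite -subr_ge0.
have -> : (r%:R - 1 + 0 - 1 / (r%:R - 1)) * (c%:R - 1) - c%:R * p%:R
  = (r%:R * (r%:R - 2) * (c%:R - 1) - c%:R * p%:R * (r%:R - 1)) / (r%:R - 1) :> R.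
  by field; rewrite gt_eqF.
apply: divr_ge0; last lra.
have : 0 <= c%:R * (r%:R - 1) * (r%:R - 2 - p%:R) :> R by rewrite !mulr_ge0//; lra.
have : 0 <= (r%:R - 2) * (c%:R - r%:R) :> R by rewrite mulr_ge0//; lra.
lra.
Qed.

Lemma cauchy_schwarz_sqrt (R : realType) (V : finType) (P : pred V) (x y : V -> R) :
  (forall v, 0 <= x v) -> (forall v, 0 <= y v) ->
  (\sum_(v | P v) Num.sqrt (x v * y v)) ^+ 2 <= (\sum_(v | P v) x v) * \sum_(v | P v) y v.
Proof.
move=> x0 y0; set A := \sum_(v | P v) x v; set B := \sum_(v | P v) y v.
set C := \sum_(v | P v) _.
have B0 : 0 <= B by rewrite sumr_ge0.
have [B00|Bn0] := eqVneq B 0.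
  have y00 v : P v -> y v = 0.
    by move=> Pv; apply/eqP; have /(psumr_eq0P (fun v _ => y0 v))/(_ v Pv)/eqP := B00.
  rewrite /C big1 ?expr0n /= ?B00 ?mulr0// => v Pv.
  by rewrite y00// mulr0 sqrtr0.
have Bp : 0 < B by rewrite lt_neqAle eq_sym Bn0.
have H : 0 <= \sum_(v | P v) (B * Num.sqrt (x v) - C * Num.sqrt (y v)) ^+ 2.
  by apply: sumr_ge0 => v _; exact: sqr_ge0.
have E (t1 t2 : R) : \sum_(v | P v) (t1 * Num.sqrt (x v) - t2 * Num.sqrt (y v)) ^+ 2 =
    t1 ^+ 2 * A - 2 * t1 * t2 * C + t2 ^+ 2 * B.
  rewrite /A /B /C !mulr_sumr -sumrB -big_split/=; apply: eq_bigr => v _.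
  have xE := sqr_sqrtr (x0 v); have yE := sqr_sqrtr (y0 v).
  rewrite sqrtrM//; set p := Num.sqrt (x v) in xE *; set q := Num.sqrt (y v) in yE *.
  by rewrite -xE -yE; ring.
have : 0 <= B * (A * B - C ^+ 2) by move: H; rewrite E; congr (_ <= _); ring.
by rewrite pmulr_rge0// subr_ge0.
Qed.

(** * Cliques *)

Section Cliques.
Variables (V : finType) (e : rel V).
Hypothesis (eS : symmetric e).

Lemma cliqueP (Q : {set V}) :
  reflect (forall x y, x \in Q -> y \in Q -> x != y -> e x y) (is_clique e Q).
Proof.
apply: (iffP forallP) => [h x y xQ yQ xy|h x].
  by have /implyP/(_ xQ)/forallP/(_ y)/implyP/(_ yQ)/implyP := h x; exact.
apply/implyP => xQ; apply/forallP => y; apply/implyP => yQ; apply/implyP.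
exact: h.
Qed.

Lemma clique_sub (K Q : {set V}) : K \subset Q -> is_clique e Q -> is_clique e K.
Proof.
move=> /fintype.subsetP KQ /cliqueP h; apply/cliqueP => x y /KQ xQ /KQ yQ; exact: h.
Qed.

Lemma clique_add (x : V) (K : {set V}) :
  (forall k, k \in K -> e x k) -> is_clique e K -> is_clique e (x |: K).
Proof.
move=> xK /cliqueP h; apply/cliqueP => y z; rewrite !inE.
case/predU1P => [->|yK]; case/predU1P => [->|zK].
- by rewrite eqxx.
- by move=> _; exact: xK.
- by move=> _; rewrite eS; exact: xK.
- exact: h.
Qed.
End Cliques.

(** * Weights of independent sets *)

Section Psd.
Variables (R : realType) (V : finType) (e : rel V) (b : V -> R) (N : V -> V -> R).
Hypotheses (b0 : forall v, 0 <= b v) (b1 : \sum_v b v = 1) (dN : dnn_kernel N).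
Hypothesis row : forall u, \sum_v N u v = b u.

(** Apply positive semidefiniteness to [f] minus its [b]-mean; the row sums
    turn the mixed terms into squares of the mean. *)
Lemma psd_mean (f : V -> R) : (\sum_v b v * f v) ^+ 2 <= qform N f.
Proof.
have [NS _ Np] := dN.
set t := \sum_v b v * f v.
have := Np (fun v => f v - t).
suff -> : qform N (fun v => f v - t) = qform N f - t ^+ 2 by rewrite subr_ge0.
rewrite /qform.
transitivity (\sum_u ((\sum_v f u * f v * N u v) - t * (\sum_v f v * N u v)
   - t * (f u * \sum_v N u v) + t ^+ 2 * \sum_v N u v)).
  apply: eq_bigr => u _; rewrite !mulr_sumr -!sumrB -big_split/=.
  by apply: eq_bigr => v _; ring.
rewrite big_split/= !sumrB -!mulr_sumr.
have -> : \sum_u \sum_v f v * N u v = t.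
  rewrite exchange_big/=; apply: eq_bigr => v _; rewrite -mulr_sumr mulrC.
  by under eq_bigr do rewrite NS; rewrite row.
have -> : \sum_u f u * \sum_v N u v = t.
  by apply: eq_bigr => u _; rewrite row mulrC.
have -> : \sum_u \sum_v N u v = 1 by rewrite -b1; apply: eq_bigr => u _.
ring.
Qed.

Definition mass (X : pred V) : R := \sum_v b v * (X v)%:R.

Lemma mass_ge0 X : 0 <= mass X.
Proof. by apply: sumr_ge0 => v _; rewrite mulr_ge0. Qed.

(** With [Y] empty this bounds the weight of an independent set by [y].  In
    general [psd_mean] is applied to the indicator of [X] plus a multiple [k] of
    that of [Y].  Since no edge joins [X] to [X] or to [Y], all the entries that
    [f] picks up in a row of [X] lie on non-neighbours, where the row has mass
    at most [y * b x].  The optimal multiple is [k = mass X / (1 - mass Y)]. *)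
Lemma independent_mass (X Y : pred V) (y : R) :
    (forall x z, X x -> X z -> ~~ e x z) -> (forall x z, X x -> Y z -> ~~ e x z) ->
    (forall x, X x -> ~~ Y x) ->
    (forall x, X x -> \sum_(z | ~~ e x z) N x z <= y * b x) ->
    0 < mass X -> mass Y < 1 ->
  mass X <= y * (1 - mass Y).
Proof.
move=> XX XY Xn Xy u0 s1.
have [NS N0 _] := dN.
set u := mass X in u0 *; set s := mass Y in s1 *.
have s1' : 0 < 1 - s by rewrite subr_gt0.
pose k := u / (1 - s).
have k0 : 0 < k by rewrite divr_gt0.
have kE : k * (1 - s) = u by rewrite /k mulfVK// gt_eqF.
pose f v := (X v)%:R + k * (Y v)%:R.
have fE : \sum_v b v * f v = k.
  transitivity (u + k * s); last by rewrite -kE; ring.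
  rewrite /u /s /mass mulr_sumr -big_split/=.
  by apply: eq_bigr => v _; rewrite /f; ring.
pose h x z := (X x && ~~ e x z)%:R + k ^+ 2 * (Y x)%:R.
(* On pairs in [X * Y] this is [2 * k <= 1 + k^2]. *)
have fh x z : f x * f z + f z * f x <= h x z + h z x.
  have kk : 2 * k <= 1 + k ^+ 2 by have := sqr_ge0 (k - 1); lra.
  have k2 := sqr_ge0 k.
  rewrite /f /h; have := XX x z; have := XX z x; have := XY x z; have := XY z x.
  have := Xn x; have := Xn z.
  case: (X x); case: (X z); case: (Y x); case: (Y z); case: (e x z); case: (e z x);
    move=> // a1 a2 a3 a4 a5 a6; rewrite /= ?mulr1 ?mulr0 ?addr0 ?add0r;
    try (by move: (a1 isT)); try (by move: (a2 isT));
    try (by move: (a3 isT isT)); try (by move: (a4 isT isT));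
    try (by move: (a5 isT isT)); try (by move: (a6 isT isT)); lra.
have Q1 : qform N f <= \sum_x \sum_z h x z * N x z.
  suff : 2 * qform N f <= 2 * \sum_x \sum_z h x z * N x z by lra.
  have -> : 2 * qform N f = \sum_x \sum_z (f x * f z + f z * f x) * N x z.
    rewrite /qform mulr_sumr; apply: eq_bigr => x _; rewrite mulr_sumr.
    by apply: eq_bigr => z _; ring.
  have -> : 2 * (\sum_x \sum_z h x z * N x z) = \sum_x \sum_z (h x z + h z x) * N x z.
    have E : \sum_x \sum_z h z x * N x z = \sum_x \sum_z h x z * N x z.
      rewrite exchange_big/=; apply: eq_bigr => x _; apply: eq_bigr => z _.
      by rewrite NS.
    transitivity (\sum_x \sum_z h x z * N x z + \sum_x \sum_z h z x * N x z).
      by rewrite E; ring.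
    rewrite -big_split/=; apply: eq_bigr => x _.
    by rewrite -big_split/=; apply: eq_bigr => z _; rewrite [RHS]mulrDl.
  by apply: ler_sum => x _; apply: ler_sum => z _; apply: ler_wpM2r.
have Q2 : \sum_x \sum_z h x z * N x z <= y * u + k ^+ 2 * s.
  rewrite /u /s /mass !mulr_sumr -big_split/=; apply: ler_sum => x _.
  have -> : \sum_z h x z * N x z =
     (X x)%:R * (\sum_(z | ~~ e x z) N x z) + k ^+ 2 * (Y x)%:R * b x.
    rewrite -row [in X in _ = X + _]big_mkcond/= !mulr_sumr -big_split/=.
    apply: eq_bigr => z _; rewrite /h.
    by case: (X x); case: (e x z); rewrite /=; ring.
  have [Xx|_] := boolP (X x) => /=; last by rewrite !mul0r mulr0 mulr0 add0r; lra.
  by have := Xy _ Xx; rewrite mul1r mulr1; lra.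
have := le_trans (psd_mean f) (le_trans Q1 Q2); rewrite fE => H.
have : k * u <= y * u.
  by rewrite -{1}kE; lra.
rewrite ler_pM2r// => ky.
by rewrite -kE ler_pM2r.
Qed.
End Psd.

(** * No maximiser has value greater than 1 *)

Section Extremal.
Variables (R : realType) (V : finType) (e : rel V) (c : V -> nat).
Hypotheses (eS : symmetric e) (eI : irreflexive e).
Hypothesis c_clique : forall (Q : {set V}) v, is_clique e Q -> v \in Q -> (#|Q| <= c v)%N.
Variables (b : V -> R) (N : V -> V -> R) (lam : R).
Hypotheses (b0 : forall v, 0 <= b v) (b1 : \sum_v b v = 1) (dN : dnn_kernel N).
Hypothesis row : forall u, \sum_v N u v = b u.

Let kap (v : V) : R := 1 - 1 / (c v)%:R.
Let g (v : V) : R := (kap v)^-1.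
Hypothesis loadE : forall u, load e g b N u = lam * b u.
Hypothesis lam1 : 1 < lam.

Let D (u : V) := \sum_(v | e u v) g v * b v.
Let m (u : V) := \sum_(v | e u v) N u v.
Let y (u : V) := 1 - m u / b u.

Lemma c_ge1 v : (1 <= c v)%N.
Proof.
have := @c_clique [set v] v; rewrite cards1 inE eqxx; apply=> //.
by apply/cliqueP => x z; rewrite !inE => /eqP -> /eqP ->; rewrite eqxx.
Qed.

Lemma b_eq0 v : b v <= 0 -> b v = 0.
Proof. by move=> bv; apply/eqP; rewrite eq_le bv b0. Qed.

Lemma kap_ge0 v : 0 <= kap v.
Proof.
rewrite /kap subr_ge0 div1r invf_le1 ?ltr0n ?c_ge1//.
by rewrite ler1n c_ge1.
Qed.

Lemma g_ge0 v : 0 <= g v. Proof. by rewrite invr_ge0 kap_ge0. Qed.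

Lemma D_ge0 u : 0 <= D u.
Proof. by apply: sumr_ge0 => v _; rewrite mulr_ge0// g_ge0. Qed.

Lemma m_le u : m u <= b u.
Proof.
have [_ N0 _] := dN; by rewrite -row (bigID (e u))/= ler_wpDr// sumr_ge0.
Qed.

(** If [c u = 1] then [k u = 0]; the load of [u] is then 0, so [u] carries no weight. *)
Lemma active_c u : 0 < b u -> (2 <= c u)%N.
Proof.
move=> bu; rewrite ltn_neqAle c_ge1 andbT; apply/eqP => c1.
have gu : g u = 0 by rewrite /g /kap -c1 divr1 subrr invr0.
have : lam * b u = 0.
  by rewrite -loadE /load big1// => v _; rewrite gu !mul0r sqrtr0.
have lb : 0 < lam * b u by rewrite mulr_gt0// (lt_trans ltr01).
by move=> E; rewrite E ltxx in lb.
Qed.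

(** Cauchy-Schwarz for [load u], separating the weights of the neighbours from
    the entries of row [u]; [1 < lam] makes the inequality strict. *)
Lemma active_D u : 0 < b u -> kap u < (1 - y u) * D u.
Proof.
move=> bu; have c2 := active_c bu; have l1 := lam1.
have C2 : 2 <= (c u)%:R :> R by rewrite (ler_nat _ 2).
have k0 : 0 < kap u by rewrite /kap subr_gt0 div1r invf_lt1; lra.
have [_ N0 _] := dN.
have := @cauchy_schwarz_sqrt R V (e u) (fun v => g v * b v) (fun v => g u * b u * N u v).
have -> : \sum_(v | e u v) Num.sqrt (g v * b v * (g u * b u * N u v)) = lam * b u.
  by rewrite -loadE; apply: eq_bigr => v _; congr Num.sqrt; ring.
rewrite -mulr_sumr -/(D u) -/(m u) => H.
have {}H : (lam * b u) ^+ 2 <= D u * (g u * b u * m u).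
  by apply: H => v; rewrite !mulr_ge0// g_ge0.
rewrite /y subKr.
have : kap u * b u * (b u * lam ^+ 2) <= b u * (D u * m u).
  have -> : b u * (D u * m u) = kap u * (D u * (g u * b u * m u)).
    by rewrite /g; field; rewrite gt_eqF.
  have -> : kap u * b u * (b u * lam ^+ 2) = kap u * (lam * b u) ^+ 2 by ring.
  by rewrite ler_pM2l.
rewrite mulrCA ler_pM2l// => H2.
rewrite mulrAC ltr_pdivlMr// [X in _ < X]mulrC.
apply: lt_le_trans H2.
rewrite -[X in X < _]mulr1 ltr_pM2l ?mulr_gt0//.
nra.
Qed.

Lemma y_ge0 u : 0 < b u -> 0 <= y u.
Proof. by move=> bu; rewrite /y subr_ge0 ler_pdivrMr// mul1r m_le. Qed.

Lemma D_gt u : 0 < b u -> kap u < D u.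
Proof.
move=> bu; have := active_D bu; have := y_ge0 bu; have := D_ge0 u.
have : 0 <= m u by have [_ N0 _] := dN; rewrite sumr_ge0.
move=> m0 D0 y0; nra.
Qed.

Lemma nonneighbour_row u : 0 < b u -> \sum_(z | ~~ e u z) N u z = y u * b u.
Proof.
move=> bu; have := row u; rewrite (bigID (e u))/= -/(m u) => E.
by rewrite /y mulrBl mul1r mulfVK ?gt_eqF//; lra.
Qed.

Section OptimalClique.
Variables (Q : {set V}) (r : nat).
Hypotheses (Qcl : is_clique e Q) (Qb : forall q, q \in Q -> 0 < b q) (Qr : #|Q| = r).
Hypothesis r2 : (2 <= r)%N.
Hypothesis size_max : forall K : {set V}, is_clique e K -> (forall q, q \in K -> 0 < b q) ->
  (#|K| <= r)%N.
Hypothesis y_max : forall K : {set V}, is_clique e K -> (forall q, q \in K -> 0 < b q) ->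
  #|K| = r -> \sum_(q in K) y q <= \sum_(q in Q) y q.

Let P (v : V) : {set V} := [set q in Q | e q v].
Let miss (v : V) : nat := #|[set q in Q | ~~ e q v]|.
Let p (v : V) : nat := #|P v|.

Lemma p_miss v : (p v + miss v = r)%N.
Proof.
rewrite -Qr -(cardsID [set q | e q v] Q) /p /miss; congr (_ + _)%N.
  by apply: eq_card => q; rewrite !inE.
by apply: eq_card => q; rewrite !inE andbC.
Qed.

Lemma P_clique v : is_clique e (v |: P v).
Proof.
apply: clique_add => // [k|]; first by rewrite inE eS => /andP[].
by apply: clique_sub Qcl; apply/fintype.subsetP => q; rewrite inE => /andP[].
Qed.

Lemma card_P v : #|v |: P v| = (p v).+1.
Proof. by rewrite cardsU1 inE eI andbF. Qed.

Lemma p_lt_c v : (p v < c v)%N.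
Proof. by rewrite -card_P; apply: c_clique (P_clique v) _; rewrite !inE eqxx. Qed.

Lemma p_lt_r v : 0 < b v -> (p v < r)%N.
Proof.
move=> bv; rewrite -card_P; apply: size_max (P_clique v) _ => q.
by rewrite !inE => /predU1P[->//|/andP[/Qb]].
Qed.

Lemma Q_c q : q \in Q -> (r <= c q)%N.
Proof. by rewrite -Qr; exact: c_clique. Qed.

(** The support splits according to the four cases of [coef_bound]: [isU] for
    the vertices missing one member of [Q], [isS] for those that miss two and
    have [c v = r - 1], [isO] for the others with [c v < r], and [isL] for the
    rest. *)
Let isU : pred V := fun v => (0 < b v) && (miss v == 1%N).
Let isS : pred V := fun v => [&& 0 < b v, miss v == 2%N & (c v).+1 == r].
Let isO : pred V := fun v =>
  [&& 0 < b v, (c v < r)%N & ~~ ((miss v == 2%N) && ((c v).+1 == r))].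
Let isL : pred V := fun v => [&& 0 < b v, (r <= c v)%N & miss v != 1%N].
Let away (X : pred V) (q : V) : pred V := fun v => X v && ~~ e q v.

Lemma missE1 v : (miss v == 1)%N = ((p v).+1 == r).
Proof. by have E := p_miss v; apply/eqP/eqP; lia. Qed.

Lemma missE2 v : (miss v == 2)%N = ((p v).+2 == r).
Proof. by have E := p_miss v; apply/eqP/eqP; lia. Qed.

(** A vertex whose only non-neighbour in [Q] is [q] can take the place of [q]. *)
Lemma exchange_clique q v : q \in Q -> isU v -> ~~ e q v ->
  [/\ forall k, k \in Q -> k != q -> e k v,
      is_clique e (v |: Q :\ q) & #|v |: Q :\ q| = r].
Proof.
move=> qQ /andP[bv /cards1P[q' /setP E]] qv.
have E' k : (k \in Q) && ~~ e k v = (k == q') by have := E k; rewrite !inE.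
have qq' : q = q' by apply/eqP; rewrite -E' qQ.
subst q'.
have adj k : k \in Q -> k != q -> e k v.
  by move=> kQ; rewrite -E' kQ /= negbK.
have cl : is_clique e (v |: Q :\ q).
  apply: clique_add => // [k|]; first by rewrite !inE eS => /andP[kq kQ]; exact: adj.
  by apply: clique_sub Qcl; rewrite subD1set.
split=> //; rewrite cardsU1 !inE.
have [->|vq] /= := eqVneq v q; first by rewrite -Qr (cardsD1 q Q) qQ.
have -> : v \in Q = false.
  by apply/negP => vQ; have := adj _ vQ vq; rewrite eI.
by rewrite -Qr (cardsD1 q Q) qQ.
Qed.

(** Otherwise the exchange would increase the sum of [y] over the clique. *)
Lemma y_exchange q v : q \in Q -> isU v -> ~~ e q v -> y v <= y q.
Proof.
move=> qQ Uv qv; have [adj cl sz] := exchange_clique qQ Uv qv.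
have [bv _] := andP Uv.
have [->//|vq] := eqVneq v q.
have vQ : v \notin Q by apply/negP => vQ; have := adj _ vQ vq; rewrite eI.
have := y_max cl _ sz; rewrite big_setU1/=; last by rewrite !inE (negbTE vQ) andbF.
rewrite (big_setD1 q qQ)/= lerD2r; apply => k.
by rewrite !inE => /predU1P[->//|/andP[_ /Qb]].
Qed.

(** Two adjacent such vertices could both replace [q], giving a larger clique. *)
Lemma U_independent q x z : q \in Q -> away isU q x -> away isU q z -> ~~ e x z.
Proof.
move=> qQ /andP[Ux qx] /andP[Uz qz]; apply/negP => xz.
have [adjx clx szx] := exchange_clique qQ Ux qx.
have [adjz clz szz] := exchange_clique qQ Uz qz.
have xn : x \notin z |: Q :\ q.
  rewrite !inE negb_or; apply/andP; split.
    by apply/eqP => xE; rewrite xE eI in xz.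
  apply/negP => /andP[xq xQ]; have := adjx _ xQ xq; by rewrite eI.
have cl : is_clique e (x |: (z |: Q :\ q)).
  apply: clique_add => // k; rewrite !inE => /predU1P[->//|/andP[kq kQ]].
  by rewrite eS; exact: adjx.
have := size_max cl; rewrite cardsU1 xn szz add1n ltnn => H.
suff : false by []. apply: H => k; rewrite !inE.
case/predU1P => [->|/predU1P[->|/andP[_ /Qb//]]].
  by case/andP: Ux.
by case/andP: Uz.
Qed.

(** If [x] and [z] were adjacent, then [x], [z] and the [r - 2] neighbours of [z]
    in [Q] would form a clique of size [r], but [c z = r - 1]. *)
Lemma US_nonadjacent q x z : q \in Q -> away isU q x -> away isS q z -> ~~ e x z.
Proof.
move=> qQ /andP[Ux qx] /andP[/and3P[bz mz cz] qz]; apply/negP => xz.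
have [adjx clx szx] := exchange_clique qQ Ux qx.
have xP : x \notin z |: P z.
  rewrite !inE negb_or; apply/andP; split.
    by apply/eqP => xE; rewrite xE eI in xz.
  apply/negP => /andP[xQ xz'].
  have [xq|xq] := eqVneq x q; first by rewrite xq (negbTE qz) in xz'.
  by have := adjx _ xQ xq; rewrite eI.
have cl : is_clique e (x |: (z |: P z)).
  apply: clique_add (P_clique z) => // k; rewrite !inE => /predU1P[->//|/andP[kQ kz]].
  rewrite eS; apply: adjx => //; apply/eqP => kq; rewrite kq in kz.
  by rewrite kz in qz.
have := c_clique (v := z) cl; rewrite cardsU1 xP card_P !inE eqxx orbT => /(_ isT).
by move: mz cz; rewrite missE2 => /eqP <-; rewrite eqSS => /eqP ->; rewrite add1n ltnn.
Qed.

(** Double counting of the pairs in [Q * V]. *)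
Lemma sum_D : \sum_(q in Q) D q = \sum_v g v * b v * (p v)%:R.
Proof.
rewrite (exchange_big_dep xpredT)//=; apply: eq_bigr => v _.
rewrite sumr_const mulr_natr /p; congr (_ *+ _).
by apply: eq_card => q; rewrite !inE.
Qed.

Lemma sum_away (X : pred V) :
  \sum_(q in Q) mass b (away X q) = \sum_v b v * (X v)%:R * (miss v)%:R.
Proof.
rewrite exchange_big/=; apply: eq_bigr => v _.
rewrite -mulr_sumr -mulrA; congr (_ * _).
rewrite /away /miss; case: (X v) => /=; last by rewrite mul0r big1.
rewrite mul1r -sum1_card natr_sum big_mkcond/= [RHS]big_mkcond/=.
by apply: eq_bigr => q _; rewrite inE; case: (q \in Q); case: (e q v).
Qed.

Let rr : R := r%:R.
Let s : R := mass b isS.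
Let o : R := mass b isO.
Let t : R := mass b isL.
Let w : R := mass b isU.

Lemma rr2 : 2 <= rr. Proof. by rewrite /rr (ler_nat _ 2). Qed.

Lemma mass_partition : w + s + o + t = 1.
Proof.
rewrite -b1 /w /s /o /t /mass -!big_split/=; apply: eq_bigr => v _.
rewrite -!mulrDr /isU /isS /isO /isL.
have [bv|] := ltP 0 (b v); last first.
  by move=> /b_eq0 ->; rewrite ?mul0r//.
rewrite -[RHS]mulr1; congr (_ * _) => /=.
have h1 := p_lt_c v; have h2 := p_miss v.
case: ltnP => cr; case: eqP => m1; case: eqP => m2; case: eqP => cr1 /=;
  rewrite ?addr0 ?add0r//; exfalso; lia.
Qed.

Lemma sum_D_le : \sum_(q in Q) D q <= rr - 1 + w - o - t / (rr - 1).
Proof.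
rewrite sum_D.
have -> : rr - 1 + w - o - t / (rr - 1) = \sum_v b v *
    ((rr - 1) + (isU v)%:R - (isO v)%:R - (isL v)%:R / (rr - 1)).
  rewrite /w /o /t /mass mulr_suml -[X in X + _ - _ - _]mul1r -b1 mulr_suml.
  rewrite -big_split/= -!sumrB; apply: eq_bigr => v _; ring.
apply: ler_sum => v _.
have [bv|] := ltP 0 (b v); last first.
  by move=> /b_eq0 ->; rewrite ?mul0r ?mulr0 ?mul0r//.
rewrite mulrAC [X in X <= _]mulrC ler_pM2l//.
have := @coef_bound R _ _ _ (active_c bv) (p_lt_c v) (p_lt_r bv) r2.
by rewrite -missE1 -missE2 /isU /isO /isL bv /=.
Qed.

Lemma kap_r q : q \in Q -> 1 - 1 / rr <= kap q.
Proof.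
move=> qQ; rewrite lerD2l lerN2 !div1r lef_pV2 ?posrE ?ltr0n ?c_ge1//.
  by rewrite ler_nat Q_c.
by rewrite (leq_trans _ r2).
Qed.

Lemma mass_o_ge0 : 0 <= o. Proof. exact: mass_ge0. Qed.

(** The hypothesis on [m] in [separation_gain].  The vertices of [isS] that
    miss [q] do not contribute to [D q], and the others do so with a factor [1 / k v]
    of at most [(r - 1) / (r - 2)], or at most 2 if they belong to [isO]; as
    [D q > 1 - 1/r], not too much weight can be lost. *)
Lemma away_S_le q : q \in Q -> mass b (away isS q) <= 2 / rr + (1 - 2 / rr) * o.
Proof.
move=> qQ; have R2 := rr2; have o0 := mass_o_ge0.
have bq := Qb qQ.
have [r3|r3] := leqP 3 r; last first.
  have rE : r = 2%N by lia.
  have -> : mass b (away isS q) = 0.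
    rewrite /mass big1// => v _.
    have [/andP[/and3P[bv _ /eqP cv] _]|] := boolP (away isS q v); last by rewrite mulr0.
    by have := active_c bv; lia.
  by rewrite /rr rE divff ?pnatr_eq0// subrr mul0r addr0.
have R3 : 3 <= rr by rewrite /rr (ler_nat _ 3).
have H : D q <= (rr - 1) / (rr - 2) * (1 - mass b (away isS q)) + (rr - 3) / (rr - 2) * o.
  have -> : (rr - 1) / (rr - 2) * (1 - mass b (away isS q)) + (rr - 3) / (rr - 2) * o =
     \sum_v b v * ((rr - 1) / (rr - 2) * (1 - (away isS q v)%:R) + (rr - 3) / (rr - 2) * (isO v)%:R).
    rewrite /o /mass -[X in _ * (X - _) + _]b1 -sumrB !mulr_sumr -big_split/=.
    by apply: eq_bigr => v _; ring.
  have A1 : 0 <= (rr - 1) / (rr - 2) by apply: divr_ge0; lra.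
  have A2 : 0 <= (rr - 3) / (rr - 2) by apply: divr_ge0; lra.
  rewrite /D big_mkcond/=; apply: ler_sum => v _.
  have [qv|qv] := boolP (e q v); last first.
    apply: mulr_ge0 => //; apply: addr_ge0; apply: mulr_ge0 => //.
    by case: (away _ _ _); rewrite /= ?subrr ?subr0.
  have -> : away isS q v = false by rewrite /away qv andbF.
  rewrite subr0 mulr1 mulrC.
  have [bv|] := ltP 0 (b v); last first.
    by move=> /b_eq0 ->; rewrite ?mul0r//.
  rewrite ler_pM2l//.
  have c2 := active_c bv.
  have C2 : 2 <= (c v)%:R :> R by rewrite (ler_nat _ 2).
  have gE : g v = (c v)%:R / ((c v)%:R - 1).
    by rewrite /g /kap; field; apply/andP; split; apply: lt0r_neq0; lra.
  have [cr|cr] := leqP r (c v).+1.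
    have CR : rr <= (c v)%:R + 1 by rewrite /rr -(natrD _ _ 1) ler_nat addn1.
    apply: ler_wpDr; first by rewrite mulr_ge0.
    rewrite gE ler_pdivrMr; last lra.
    by rewrite mulrAC ler_pdivlMr; lra.
  have -> : isO v.
    by rewrite /isO bv (ltn_trans (ltnSn _) cr) /= negb_and (ltn_eqF cr) orbT.
  have -> : (rr - 1) / (rr - 2) + (rr - 3) / (rr - 2) * 1 = 2.
    by field; apply: lt0r_neq0; lra.
  by rewrite gE ler_pdivrMr; lra.
have := lt_le_trans (le_lt_trans (kap_r qQ) (D_gt bq)) H.
have r20 : 0 < rr - 2 by lra.
have r0 : 0 < rr by lra.
have -> : (rr - 1) / (rr - 2) * (1 - mass b (away isS q)) + (rr - 3) / (rr - 2) * o =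
   ((rr - 1) * (1 - mass b (away isS q)) + (rr - 3) * o) / (rr - 2).
  by field; rewrite gt_eqF.
rewrite ltr_pdivlMr// -subr_gt0 => H1.
rewrite -subr_ge0 -(pmulr_rge0 _ (_ : 0 < rr * (rr - 1))); last by apply: mulr_gt0; lra.
have := mulr_gt0 r0 H1.
have E1 : rr * ((rr - 1) * (1 - mass b (away isS q)) + (rr - 3) * o - (1 - 1 / rr) * (rr - 2))
  = rr * (rr - 1) * (1 - mass b (away isS q)) + rr * (rr - 3) * o - (rr - 1) * (rr - 2).
  by field; rewrite gt_eqF.
have E2 : rr * (rr - 1) * (2 / rr + (1 - 2 / rr) * o - mass b (away isS q)) =
  2 * (rr - 1) + (rr - 2) * (rr - 1) * o - rr * (rr - 1) * mass b (away isS q).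
  by field; rewrite gt_eqF.
rewrite E1 E2; nra.
Qed.

(** [active_D] and [independent_mass] give
    [D q > (1 - 1/r) * (1 - s_q) / (1 - u_q - s_q)], where [u_q] and [s_q] are the
    weights of the vertices missing [q] in [isU] and in [isS]; then
    [separation_gain] makes the bound linear. *)
Lemma D_lower q : q \in Q ->
  (1 - 1 / rr) + mass b (away isU q)
   + (mass b (away isU q) + (mass b (away isS q) - (1 - 2 / rr) * o) / 2 - 1 / rr) / (rr - 1)
  < D q.
Proof.
move=> qQ; have R2 := rr2; have o0 := mass_o_ge0; have bq := Qb qQ.
set u := mass b (away isU q); set sg := mass b (away isS q).
have u_gt0 : 0 < u.
  rewrite /u /mass (bigD1 q)//= ltr_pwDl//; last by rewrite sumr_ge0// => v _; rewrite mulr_ge0.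
  have -> : away isU q q; last by rewrite mulr1.
  rewrite /away eI andbT /isU bq /=; apply/cards1P; exists q; apply/setP => k.
  rewrite !inE; have [->|kq] := eqVneq k q; first by rewrite qQ eI.
  by apply/negbTE/nandP; have [kQ|] := boolP (k \in Q); [right|left] => //; rewrite negbK (cliqueP _ _ Qcl).
have sg0 : 0 <= sg by exact: mass_ge0.
pose beta : R := \sum_(v | e q v) b v.
(* The vertices of [isU] missing [q], those of [isS] missing [q] and the
   neighbours of [q] are disjoint; the neighbours carry weight since [0 < D q], so [u + sg < 1]. *)
have usb : u + sg + beta <= 1.
  rewrite -b1 /u /sg /mass /beta [X in _ + _ + X]big_mkcond/= -!big_split/=.
  apply: ler_sum => v _.
  have [bv|] := ltP 0 (b v); last first.
    by move=> /b_eq0 ->; rewrite !mul0r if_same !addr0.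
  rewrite /away /isU /isS bv /=.
  case: (e q v) => /=; rewrite ?andbF ?andbT /= ?mulr0 ?add0r ?addr0//.
  by case: eqP => [->|_] /=; [rewrite mulr1 mulr0 addr0|case: (_ && _); rewrite ?mulr1 ?mulr0 ?add0r].
have Db : D q <= 2 * beta.
  rewrite /D /beta mulr_sumr; apply: ler_sum => v qv.
  have [bv|] := ltP 0 (b v); last first.
    by move=> /b_eq0 ->; rewrite ?mulr0//.
  rewrite ler_pM2r//.
  have C2 : 2 <= (c v)%:R :> R by rewrite (ler_nat _ 2) active_c.
  have -> : g v = (c v)%:R / ((c v)%:R - 1).
    by rewrite /g /kap; field; apply/andP; split; apply: lt0r_neq0; lra.
  by rewrite ler_pdivrMr; lra.
have beta0 : 0 < beta by have := D_gt bq; have := kap_ge0 q; lra.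
have us : u + sg < 1 by lra.
have uy : u <= y q * (1 - sg).
  apply: (@independent_mass R V e b N b1 dN row (away isU q) (away isS q) (y q)) => //.
  - by move=> x z; exact: U_independent.
  - by move=> x z; exact: US_nonadjacent.
  - by move=> x /andP[/andP[_ /eqP m1] _]; rewrite /away /isS m1 /= andbF.
  - move=> x /andP[Ux qx]; have bx : 0 < b x by case/andP: Ux.
    by rewrite nonneighbour_row// ler_pM2r// (y_exchange qQ).
  - by rewrite -/sg; lra.
have key := active_D bq.
have kr := kap_r qQ.
have D0 := D_ge0 q.
have tau : 0 < 1 - u - sg by lra.
have lower : (1 - 1 / rr) * (1 + u / (1 - u - sg)) < D q.
  have -> : 1 + u / (1 - u - sg) = (1 - sg) / (1 - u - sg).
    by field; rewrite gt_eqF.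
  rewrite mulrA ltr_pdivrMr//.
  have h1 : (1 - 1 / rr) * (1 - sg) <= kap q * (1 - sg) by rewrite ler_wpM2r//; lra.
  have h2 : kap q * (1 - sg) < (1 - y q) * D q * (1 - sg) by rewrite ltr_pM2r//; lra.
  have h3 : (1 - y q) * (1 - sg) * D q <= (1 - u - sg) * D q by rewrite ler_wpM2r//; lra.
  nra.
apply: le_lt_trans lower.
have o2 : 0 <= (1 - 2 / rr) * o.
  by apply: mulr_ge0 => //; rewrite subr_ge0 ler_pdivrMr; lra.
apply: separation_gain => //; [exact: ltW|lra|].
by have := away_S_le qQ; rewrite -/sg; lra.
Qed.

(** Summing [D_lower] over [Q] counts each vertex of [isU] once and each vertex
    of [isS] twice, since it misses two members of [Q].  Compared with
    [sum_D_le], and as the four weights add up to 1, there remains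
    [0 < - (r / 2 - 1) * o / (r - 1)]. *)
Lemma optimal_clique_absurd : False.
Proof.
have R2 := rr2; have o0 := mass_o_ge0.
have H : \sum_(q in Q) ((1 - 1 / rr) + mass b (away isU q)
   + (mass b (away isU q) + (mass b (away isS q) - (1 - 2 / rr) * o) / 2 - 1 / rr) / (rr - 1))
  < \sum_(q in Q) D q.
  have [q qQ] : exists q, q \in Q by apply/set0Pn; rewrite -card_gt0 Qr; lia.
  rewrite (bigD1 q)//= [X in _ < X](bigD1 q)//= ltr_leD ?D_lower//.
  by apply: ler_sum => k /andP[kQ _]; rewrite ltW// D_lower.
have EU : \sum_(q in Q) mass b (away isU q) = w.
  rewrite sum_away; apply: eq_bigr => v _; rewrite /isU.
  by case: (0 < b v) => /=; case: (eqVneq (miss v) 1%N) => [->|_]; rewrite ?mulr1 ?mulr0 ?mul0r.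
have ES : \sum_(q in Q) mass b (away isS q) = 2 * s.
  rewrite sum_away /s /mass mulr_sumr; apply: eq_bigr => v _; rewrite /isS.
  by case: (0 < b v) => /=; case: (eqVneq (miss v) 2%N) => [->|_] /=;
    case: (_ == r); rewrite ?mulr0 ?mul0r ?mulr1 // mulrC.
have E : \sum_(q in Q) ((1 - 1 / rr) + mass b (away isU q)
   + (mass b (away isU q) + (mass b (away isS q) - (1 - 2 / rr) * o) / 2 - 1 / rr) / (rr - 1))
  = (rr - 1) + w + (w + s - (rr - 2) * o / 2 - 1) / (rr - 1).
  rewrite !big_split/= -mulr_suml !sumrB/= big_split/= -mulr_suml sumrB EU ES !sumr_const Qr.
  have natE (x : R) : x *+ r = x * rr by rewrite /rr mulr_natr.
  rewrite !natE; field.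
  by apply/andP; split; apply: lt0r_neq0; lra.
have := lt_le_trans H sum_D_le; rewrite E -subr_gt0.
have -> : rr - 1 + w - o - t / (rr - 1) - (rr - 1 + w + (w + s - (rr - 2) * o / 2 - 1) / (rr - 1))
  = (1 - (w + s + o + t) - (rr / 2 - 1) * o) / (rr - 1).
  by field; apply: lt0r_neq0; lra.
rewrite mass_partition subrr sub0r pmulr_lgt0 ?invr_gt0; last lra.
have : 0 <= (rr / 2 - 1) * o by apply: mulr_ge0 => //; lra.
lra.
Qed.
End OptimalClique.

(** A maximum clique of the support has size at least 2, as [0 < D u] for every
    [u] in the support. *)
Lemma extremal_absurd : False.
Proof.
pose ok (K : {set V}) := is_clique e K && [forall q in K, 0 < b q].
have okP K : ok K -> is_clique e K /\ (forall q, q \in K -> 0 < b q).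
  by case/andP => h1 /forall_inP h2.
have ok0 : ok finset.set0.
  apply/andP; split; last by apply/forall_inP => q; rewrite inE.
  by apply/cliqueP => x z; rewrite inE.
have [K0 okK0 K0max] := @arg_maxnP _ finset.set0 ok (fun K => #|K|) ok0.
have bound (K : {set V}) : is_clique e K -> (forall q, q \in K -> 0 < b q) -> (#|K| <= #|K0|)%N.
  by move=> h1 h2; apply: K0max; apply/andP; split=> //; apply/forall_inP.
have r2 : (2 <= #|K0|)%N.
  have [u bu] : exists u, 0 < b u.
    apply/existsP; apply: contraT => /existsPn h.
    have : \sum_v b v = 0 by apply: big1 => v _; apply/eqP; rewrite eq_le b0 andbT leNgt h.
    by rewrite b1 => /eqP; rewrite oner_eq0.
  have : 0 < D u by have := D_gt bu; have := kap_ge0 u; lra.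
  move=> Du; have [v uv bv] : exists2 v, e u v & 0 < b v.
    apply/exists_inP; apply: contraT => /exists_inPn h.
    have : D u = 0.
      apply: big1 => v uv; have : b v = 0 by apply/eqP; rewrite eq_le b0 andbT leNgt h.
      by move->; rewrite mulr0.
    by move=> D0; rewrite D0 ltxx in Du.
  have <- : #|[set u; v]| = 2%N.
    by rewrite cards2; have [uE|//] := eqVneq u v; rewrite uE eI in uv.
  apply: bound => [|q]; last by rewrite !inE => /orP[]/eqP->.
  apply: clique_add => // [k|]; first by rewrite inE => /eqP ->.
  by apply/cliqueP => x z; rewrite !inE => /eqP -> /eqP ->; rewrite eqxx.
pose okr K := ok K && (#|K| == #|K0|).
have okrK0 : okr K0 by rewrite /okr okK0 eqxx.
have [Q /andP[okQ /eqP Qr] Qmax] :=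
  @arg_maxP _ R _ K0 okr (fun K : {set V} => \sum_(q in K) y q) okrK0.
have [Qcl Qb] := okP _ okQ.
apply: (@optimal_clique_absurd Q #|K0|) => // K cl Kb Kr.
apply: Qmax; apply/andP; split; last by rewrite Kr.
by apply/andP; split=> //; apply/forall_inP.
Qed.

End Extremal.

(** * The inequality for matrices *)

Section Bound.
Variables (R : realType) (V : finType) (e : rel V).
Hypotheses (eS : symmetric e) (eI : irreflexive e).

Lemma clique_le_local (Q : {set V}) v :
  is_clique e Q -> v \in Q -> (#|Q| <= local_clique_number e v)%N.
Proof. by move=> Qcl vQ; apply: leq_bigmax_cond; rewrite vQ. Qed.

Let kap (v : V) : R := 1 - 1 / (local_clique_number e v)%:R.

(** It suffices to consider a maximiser.  If its value were greater than 1, the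
    two first order conditions would equate the row sums with the weights. *)
Lemma objective_le1 (b : V -> R) (N : V -> V -> R) :
    (forall v, 0 <= b v) -> \sum_v b v = 1 -> dnn_kernel N -> total_mass N = 1 ->
  objective e (fun v => (kap v)^-1) b N <= 1.
Proof.
move=> b0 b1 dN N1.
have [v0 _] : exists v0 : V, true.
  apply/existsP; apply: contraT => /existsPn h; move/eqP: b1.
  by rewrite big1 ?(eq_sym 0) ?oner_eq0// => v; have := h v.
have [b' [N' [b'0 b'1 dN' N'1 bN_max]]] := objective_maximizer e (fun v => (kap v)^-1) v0.
apply: le_trans (bN_max _ _ b0 b1 dN N1) _; rewrite leNgt; apply/negP => lam1.
apply: (@extremal_absurd R V e _ eS eI clique_le_local b' N' _ b'0 b'1 dN' _ _ lam1) => u.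
  have lam0 := gt_eqF (lt_trans ltr01 lam1).
  apply: (mulfI (negbT lam0)).
  by rewrite -(load_row eS eI b'0 b'1 dN' N'1 bN_max) (load_weight eS eI b'0 b'1 dN' N'1 bN_max).
have := load_weight eS eI b'0 b'1 dN' N'1 bN_max u. exact.
Qed.

(** The case [b = k / sum k], [N / total] of [objective_le1].  When [sum k]
    vanishes there are no edges, and when the total vanishes so does [N]. *)
Lemma ordered_sqrt_sum_le (N : V -> V -> R) : dnn_kernel N ->
  \sum_u \sum_(v | e u v) Num.sqrt (N u v) <= (\sum_v kap v) * Num.sqrt (total_mass N).
Proof.
move=> dN; have [NS N0 _] := dN.
have k0 v : 0 <= kap v by exact: kap_ge0 clique_le_local v.
have kp u v : e u v -> 0 < kap u.
  move=> uv; have : (2 <= local_clique_number e u)%N.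
    have <- : #|[set u; v]| = 2%N.
      by rewrite cards2; have [uE|//] := eqVneq u v; rewrite uE eI in uv.
    apply: clique_le_local; last by rewrite !inE eqxx.
    apply: clique_add => // [k|]; first by rewrite inE => /eqP ->.
    by apply/cliqueP => x z; rewrite !inE => /eqP -> /eqP ->; rewrite eqxx.
  move=> c2; rewrite /kap subr_gt0 div1r invf_lt1 ?ltr1n// ltr0n.
  exact: ltn_trans c2.
set K := \sum_v kap v; set T := total_mass N.
have K0 : 0 <= K by exact: sumr_ge0.
have T0 : 0 <= T by exact: total_ge0.
have [Kz|Kn] := eqVneq K 0.
  rewrite big1 ?mulr_ge0 ?sqrtr_ge0// => u _; rewrite big1// => v /kp.
  have /eqP -> : kap u == 0 by have /(psumr_eq0P (fun v _ => k0 v))/(_ u isT)/eqP := Kz.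
  by rewrite ltxx.
have [Tz|Tn] := eqVneq T 0.
  rewrite big1 ?mulr_ge0 ?sqrtr_ge0// => u _; rewrite big1// => v _.
  have r0 w : 0 <= \sum_v N w v by exact: sumr_ge0.
  have Nu : \sum_v N u v = 0 by exact: (psumr_eq0P (fun v _ => r0 v) Tz).
  by rewrite (psumr_eq0P (fun v _ => N0 u v) Nu)// sqrtr0.
have Kp : 0 < K by rewrite lt_neqAle eq_sym Kn.
have Tp : 0 < T by rewrite lt_neqAle eq_sym Tn.
have sT : 0 < Num.sqrt T by rewrite sqrtr_gt0.
pose t := Num.sqrt (Num.sqrt T^-1).
have t4 : t ^+ 2 * t ^+ 2 = T^-1.
  by rewrite sqr_sqrtr ?sqrtr_ge0// -expr2 sqr_sqrtr// invr_ge0.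
have := @objective_le1 (fun v => K^-1 * kap v) (fun u v => t ^+ 2 * t ^+ 2 * N u v).
have -> : objective e (fun v => (kap v)^-1) (fun v => K^-1 * kap v)
      (fun u v => t ^+ 2 * t ^+ 2 * N u v)
    = (\sum_u \sum_(v | e u v) Num.sqrt (N u v)) / (K * Num.sqrt T).
  rewrite mulr_suml; apply: eq_bigr => u _; rewrite mulr_suml; apply: eq_bigr => v uv.
  have ku := kp _ _ uv; have kv : 0 < kap v by apply: (kp v u); rewrite eS.
  have -> : (kap u)^-1 * (K^-1 * kap u) * ((kap v)^-1 * (K^-1 * kap v)) *
      (t ^+ 2 * t ^+ 2 * N u v) = K^-1 ^+ 2 * (T^-1 * N u v).
    by rewrite t4; field; rewrite Kn Tn !gt_eqF.
  rewrite sqrtrM ?sqr_ge0// sqrtr_sqr ger0_norm ?invr_ge0//.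
  by rewrite sqrtrM ?invr_ge0// sqrtrV// invfM; ring.
rewrite ler_pdivrMr ?mulr_gt0// mul1r; apply.
- by move=> v; rewrite mulr_ge0// invr_ge0.
- by rewrite -mulr_sumr mulVf.
- by apply: (@dnn_conj R V N (fun=> t)) => // _; exact: sqrtr_ge0.
- rewrite /total_mass (eq_bigr (fun u => T^-1 * \sum_v N u v)) => [|u _].
    by rewrite -mulr_sumr mulVf.
  by rewrite mulr_sumr t4.
Qed.
End Bound.

Lemma quadratic_form_entry (R : realType) (V : finType) (M : 'M[R]_#|V|) (x : 'cV[R]_#|V|) :
  (x^T *m M *m x) 0 0 = qform (entry M) (fun v => x (enum_rank v) 0).
Proof.
have rb : {on [pred _ : 'I_#|V| | true], bijective (@enum_rank V)}.
  by apply: onW_bij; exact: enum_rank_bij.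
rewrite mxE (reindex _ rb)/= /qform exchange_big/=; apply: eq_bigr => v _.
rewrite mxE (reindex _ rb)/= mulr_suml; apply: eq_bigr => u _.
by rewrite !mxE /entry mulrAC.
Qed.

Lemma dnn_entry (R : realType) (V : finType) (M : 'M[R]_#|V|) :
  doubly_nonnegative M -> dnn_kernel (entry M).
Proof.
case=> [[MS Mp] M0]; split=> [u v|u v|f].
- by move/is_hermitianmxP: MS => MS; rewrite /entry {1}MS !mxE expr0 mul1r.
- exact: M0.
- have := Mp (\col_i f (enum_val i)); rewrite quadratic_form_entry /qform.
  congr (_ <= _); apply: eq_bigr => u _; apply: eq_bigr => v _.
  by rewrite !mxE !enum_rankK.
Qed.

Lemma total_weight_entry (R : realType) (V : finType) (M : 'M[R]_#|V|) :
  total_weight M = total_mass (entry M).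
Proof.
rewrite /total_weight quadratic_form_entry.
by apply: eq_bigr => u _; apply: eq_bigr => v _; rewrite !mxE !mul1r.
Qed.

(** Exchanging the two ends matches the pairs decreasing for [enum_rank] with the
    increasing ones. *)
Lemma edge_sqrt_sum_ordered (R : realType) (V : finType) (adj : rel V) (M : 'M[R]_#|V|) :
    simple_graph adj -> (forall u v, entry M u v = entry M v u) ->
  2 * edge_sqrt_sum adj M = \sum_u \sum_(v | adj u v) Num.sqrt (entry M u v).
Proof.
move=> [aS aI] MS; rewrite pair_big_dep/= mulr_natl mulr2n.
rewrite [RHS](bigID (fun p : V * V => (enum_rank p.1 < enum_rank p.2)%N))/=.
congr (_ + _).
rewrite /edge_sqrt_sum.
have swap_inj : injective (fun p : V * V => (p.2, p.1)) by move=> [? ?] [? ?] [-> ->].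
rewrite (reindex_inj swap_inj)/=; apply: eq_big => [[u v]|[u v] _] /=; last by rewrite MS.
rewrite aS; case uv: (adj u v) => //=; rewrite -leqNgt ltn_neqAle.
suff -> : enum_rank v != enum_rank u :> nat by [].
by apply/eqP => /ord_inj/enum_rank_inj uE; rewrite uE aI in uv.
Qed.

Theorem theorem3p2 (R : realType) (V : finType) (adj : rel V)
    (M : 'M[R]_#|V|) (hG : simple_graph adj) (hM : doubly_nonnegative M) :
  2 * edge_sqrt_sum adj M <=
    \sum_(v : V) (1 - 1 / (local_clique_number adj v)%:R) *
      Num.sqrt (total_weight M).
Proof.
have [aS aI] := hG; have dM := dnn_entry hM; have [MS _ _] := dM.
rewrite edge_sqrt_sum_ordered// -mulr_suml total_weight_entry.
exact: ordered_sqrt_sum_le.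
Qed.
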